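(* Let $(\mathcal{K},[\cdot,\cdot])$ be an $N$-dimensional Pontryagin space with fundamental symmetry $J$, and let $S_0$ be a linear operator on $\mathcal{K}$ which is $J$-self-adjoint and positive with respect to $[\cdot,\cdot]_J$. Let $\lambda_1\ge\lambda_2\ge\cdots\ge\lambda_N>0$ be the eigenvalues of $S_0$ (counted with multiplicity). Fix $k\ge N$ and real numbers $a_1\ge a_2\ge\cdots\ge a_k>0$. The following are equivalent: (i) For every $1\le j\le N$, $\sum_{n=1}^{j}a_n^2\le\sum_{n=1}^{j}\lambda_n$, and $\sum_{n=1}^{k}a_n^2=\sum_{n=1}^{N}\lambda_n$. (ii) There is a frame $\{x_n\}_{n=1}^k$ for the Hilbert space $(\mathcal{K},[\cdot,\cdot]_J)$ with frame operator $S_0$ and $\|x_n\|_J=a_n$ for all $n=1,\ldots,k$. (iii) There is a frame $\{x_n\}_{n=1}^k$ for the Pontryagin space $\mathcal{K}$ with frame operator $S_0J$ and $\|x_n\|_J=a_n$ for all $n=1,\ldots,k$. (iv) There is a frame of the form $\{Jx_n\}_{n=1}^k$ for the Pontryagin space $\mathcal{K}$ with frame operator $JS_0$ and $\|x_n\|_J=a_n$ for all $n=1,\ldots,k$. (v) There is a frame of the form $\{Jx_n\}_{n=1}^k$ for the Hilbert space $(\mathcal{K},[\cdot,\cdot]_J)$ with frame operator $JS_0J$ and $\|x_n\|_J=a_n$ for all $n=1,\ldots,k$.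
   Context: All vector spaces are over $\mathbb{C}$ and sesquilinear forms are linear in the first variable. A Krein space is a vector space $\mathcal{K}$ with a sesquilinear form $[\cdot,\cdot]$ and a decomposition $\mathcal{K}=\mathcal{K}^+\oplus\mathcal{K}^-$ such that $\mathcal{K}^+,\mathcal{K}^-$ are orthogonal with respect to $[\cdot,\cdot]$ and $(\mathcal{K}^+,[\cdot,\cdot])$, $(\mathcal{K}^-,-[\cdot,\cdot])$ are Hilbert spaces. It is a Pontryagin space if $0<\min\{\dim\mathcal{K}^+,\dim\mathcal{K}^-\}<\infty$. If $P^\pm$ are the projections onto $\mathcal{K}^\pm$ along this decomposition, the fundamental symmetry is $J=P^+-P^-$; then $[x,y]_J:=[Jx,y]$ is a Hilbert space inner product on $\mathcal{K}$, with norm $\|x\|_J=\sqrt{[x,x]_J}$. An operator $T$ is $J$-self-adjoint if it equals its adjoint in the Hilbert space $(\mathcal{K},[\cdot,\cdot]_J)$, and positive with respect to $[\cdot,\cdot]_J$ if $[Tx,x]_J\ge0$ for all $x$. A family $\{x_n\}_{n=1}^k$ in $\mathcal{K}$ is a frame for the Krein (or Pontryagin) space $\mathcal{K}$ if there are constants $0<A\le B<\infty$ with $A\|x\|_J^2\le\sum_{n=1}^k|[x_n,x]|^2\le B\|x\|_J^2$ for all $x\in\mathcal{K}$; its frame operator is $Sx=\sum_{n=1}^k[x,x_n]x_n$. A frame for the Hilbert space $(\mathcal{K},[\cdot,\cdot]_J)$ is defined in the same way with $[\cdot,\cdot]$ replaced by $[\cdot,\cdot]_J$, and its frame operator is $Sx=\sum_{n=1}^k[x,x_n]_Jx_n$.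 *)

(* Defs.v *)
From mathcomp Require Import all_boot all_order all_algebra.
From mathcomp Require Import reals complex.

Set Implicit Arguments.
Unset Strict Implicit.
Unset Printing Implicit Defensive.

Import Order.TTheory GRing.Theory Num.Theory.
Local Open Scope complex_scope.
Local Open Scope ring_scope.

(* Linear in the first variable, conjugate-linear in the second. *)
Notation "{ 'sesquilinear' K 'over' R }" :=
  {bilinear K -> K -> R[i] | *%R & (@Num.conj R[i]) \; *%R}
  (at level 0, K at level 99, R at level 99,
   format "{ 'sesquilinear'  K  'over'  R }") : ring_scope.

Section Hilbert.
Variables (R : realType) (K : vectType R[i]).
Implicit Types (f : K -> K -> R[i]) (V : {vspace K}).

Definition form_norm f (x : K) : R[i] := sqrtC (f x x).

Definition inner_product_on f V : Prop :=
  (forall x y, x \in V -> y \in V -> f y x = (f x y)^*) /\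
  (forall x, x \in V -> x != 0 -> 0 < f x x).

(* Completeness is automatic here, every subspace being finite-dimensional;
   it is part of the definition of a Hilbert space and therefore kept. *)
Definition complete_on f V : Prop :=
  forall u : nat -> K, (forall n, u n \in V) ->
  (forall e : R, 0 < e -> exists n0 : nat, forall m n : nat,
     (n0 <= m)%N -> (n0 <= n)%N -> form_norm f (u m - u n) < e%:C) ->
  exists2 l, l \in V & forall e : R, 0 < e -> exists n0 : nat, forall n : nat,
     (n0 <= n)%N -> form_norm f (u n - l) < e%:C.

Definition hilbert_on f V : Prop := inner_product_on f V /\ complete_on f V.

End Hilbert.

Section Krein.
Variables (R : realType) (K : vectType R[i]).
Variable form : {sesquilinear K over R}.
Variables Kp Km : {vspace K}.

Definition krein_space : Prop :=
  [/\ (Kp + Km = fullv)%VS /\ (Kp :&: Km = 0)%VS,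
      forall x y, x \in Kp -> y \in Km -> form x y = 0 /\ form y x = 0,
      hilbert_on form Kp
    & hilbert_on (fun x y => - form x y) Km].

Definition pontryagin_space : Prop :=
  krein_space /\ (0 < minn (\dim Kp) (\dim Km))%N.

(* [daddv_pi U V] is the projection onto U along V. *)
Definition fundamental_symmetry : 'End(K) := daddv_pi Kp Km - daddv_pi Km Kp.

Definition J_form (x y : K) : R[i] := form (fundamental_symmetry x) y.

Definition J_norm (x : K) : R[i] := form_norm J_form x.

Definition J_adjoint (T T' : 'End(K)) : Prop :=
  forall x y, J_form (T x) y = J_form x (T' y).

Definition J_self_adjoint (T : 'End(K)) : Prop := J_adjoint T T.

Definition J_positive (T : 'End(K)) : Prop := forall x, 0 <= J_form (T x) x.

(* The frame inequality for an arbitrary pairing f; f is [form] for the Krein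
   space and [J_form] for the Hilbert space, with the same norm in both cases. *)
Definition frame_for (f : K -> K -> R[i]) (k : nat) (x_ : 'I_k -> K) : Prop :=
  exists A B : R, [/\ 0 < A, A <= B & forall x : K,
    A%:C * J_norm x ^+ 2 <= \sum_(n < k) `|f (x_ n) x| ^+ 2
                         <= B%:C * J_norm x ^+ 2].

Definition krein_frame k (x_ : 'I_k -> K) := frame_for form x_.
Definition hilbert_frame k (x_ : 'I_k -> K) := frame_for J_form x_.

Definition frame_operator (f : K -> K -> R[i]) k (x_ : 'I_k -> K) (x : K) : K :=
  \sum_(n < k) f x (x_ n) *: x_ n.

Definition krein_frame_operator k (x_ : 'I_k -> K) := frame_operator form x_.
Definition hilbert_frame_operator k (x_ : 'I_k -> K) := frame_operator J_form x_.

End Krein.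

(* The characteristic polynomial of an endomorphism is basis-independent; it is
   computed here in the basis chosen by the library. *)
Definition char_poly_end (F : fieldType) (K : vectType F) (T : 'End(K)) :
    {poly F} :=
  char_poly (passmx.mxof (vbasis {:K}) (vbasis {:K}) T).

(* l lists the eigenvalues of T, repeated according to (algebraic)
   multiplicity. *)
Definition eigenvalues_with_mult (R : realType) (K : vectType R[i])
    (T : 'End(K)) (N : nat) (l : 'I_N -> R) : Prop :=
  char_poly_end T = \prod_(i < N) ('X - ((l i)%:C)%:P).

(* Main.v *)
Require Import Defs.
From HB Require Import structures.
From mathcomp Require Import all_boot all_order all_fingroup all_algebra.
From mathcomp Require Import reals complex.
From mathcomp Require Import ring.

(* In a J-orthonormal eigenbasis of S0 with eigenvalues l, a family (x_n) is a
   k x N matrix X, its Hilbert frame operator is S0 iff X^* X = diag l, and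
   |x_n|_J^2 is the n-th diagonal entry of X X^*.
   Necessity of (i): |x_n|_J^2 = sum_i l_i w_ni with w_ni = |X_ni|^2 / l_i, where
   the columns of w sum to 1 and its rows to at most 1, as X diag(l)^-1 X^* is a
   projection; so a sum of j squared norms is at most l_1 + ... + l_j.
   Sufficiency: by Horn's theorem some orthogonal U makes (a_n^2) the diagonal of
   U diag(l, 0) U^T; take X = U diag(sqrt l), restricted to N columns.
   Conditions (ii)-(v) are exchanged by J, using [x, y]_J = [Jx, y]. *)

Set Implicit Arguments.
Unset Strict Implicit.
Unset Printing Implicit Defensive.

Import Order.TTheory GRing.Theory Num.Theory.
Local Open Scope complex_scope.
Local Open Scope ring_scope.
Local Open Scope sesquilinear_scope.

(** * Horn's theorem by plane rotations *)

(** Matrices are functions on [nat], read only below [n], so that prepending a row and a column is a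
    case analysis on indices. *)
Definition orthonormal_rows (R : pzRingType) n (U : nat -> nat -> R) :=
  forall i j, (i < n)%N -> (j < n)%N ->
    \sum_(0 <= m < n) U i m * U j m = (i == j)%:R.

(* [a] is the diagonal of U diag(l) U^T for some real orthogonal matrix U. *)
Definition orthogonal_diag (R : pzRingType) (l a : seq R) :=
  exists2 U : nat -> nat -> R, orthonormal_rows (size l) U &
    forall i, (i < size l)%N ->
      \sum_(0 <= m < size l) U i m ^+ 2 * l`_m = a`_i.

(** The columns of [U] are permuted along with the entries of [l]. *)
Lemma orthogonal_diag_perm (R : pzRingType) (l l' a : seq R) :
  perm_eq l l' -> orthogonal_diag l' a -> orthogonal_diag l a.
Proof.
move=> ll' [U Uo Ud]; have sz := perm_size ll'.
have /(perm_iotaP 0)[s ps ls] := ll'.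
have szs : size s = size l by rewrite ls size_map.
have reidx (F : nat -> R) :
    \sum_(0 <= m < size l) F (nth 0%N s m) = \sum_(0 <= m < size l') F m.
  rewrite -szs -(big_nth 0%N predT F) (perm_big _ ps).
  by rewrite /index_iota subn0.
exists (fun i m => U i (nth 0%N s m)) => [i j|i] lti.
  by move=> ltj; rewrite (reidx (fun m => U i m * U j m)) Uo // -sz.
rewrite -Ud; last by rewrite -sz.
rewrite -reidx; apply: eq_big_nat => m /andP[_ ltm].
by congr (_ * _); rewrite ls (nth_map 0%N) // szs.
Qed.

(** [z] is a convex combination of [x] and [y]; cosine and sine are the square roots of the
    weights. *)
Lemma rotation_weights (R : rcfType) (x y z : R) : y <= z -> z <= x ->
  exists c s : R, c ^+ 2 + s ^+ 2 = 1 /\ c ^+ 2 * x + s ^+ 2 * y = z.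
Proof.
move=> yz zx; have [/eqP xy|xy] := boolP (x == y).
  (* Here [z] equals both, so the identity rotation serves; the quotients used below would have
     denominator 0. *)
  exists 1, 0; rewrite expr1n expr0n /= addr0 mul1r mul0r addr0; split => //.
  by apply/eqP; rewrite eq_le zx xy yz.
have ltyx : 0 < x - y by rewrite subr_gt0 lt_neqAle eq_sym xy (le_trans yz).
exists (Num.sqrt ((z - y) / (x - y))), (Num.sqrt ((x - z) / (x - y))).
rewrite !sqr_sqrtr ?divr_ge0 ?subr_ge0 //; try exact: le_trans zx.
by split; field; rewrite lt0r_neq0.
Qed.

(* A plane rotation moves the first two diagonal entries x, y to z, x + y - z;
   deleting the first row and column leaves a diagonal matrix again. *)
Lemma orthogonal_diag_cons2 (R : rcfType) (x y z : R) (l a : seq R) :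
  y <= z -> z <= x -> orthogonal_diag (x + y - z :: l) a ->
  orthogonal_diag [:: x, y & l] (z :: a).
Proof.
move=> yz zx [U Uo Ud]; have [c [s [cs1 csz]]] := rotation_weights yz zx.
have csw : s ^+ 2 * x + c ^+ 2 * y = x + y - z.
  by rewrite -csz -[x + y in RHS]mul1r -cs1; ring.
(* [V] is the block matrix diag(1, [U]) times the rotation of the first two coordinates with rows
   ([c], [s]) and (-[s], [c]). *)
pose V i m := if i is i'.+1 then
    match m with 0 => - s * U i' 0 | 1 => c * U i' 0 | m'.+2 => U i' m'.+1 end
  else match m with 0 => c | 1 => s | _ => 0 end.
rewrite /orthonormal_rows /= in Uo Ud.
exists V => [[|i] [|j]|[|i]] //= lti.
- by move=> _; rewrite !big_nat_recl //= big1 ?addr0 => [|m _]; rewrite ?mulr0 // -!expr2.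
- move=> ltj; rewrite !big_nat_recl //= big1 ?addr0; first by ring.
  by move=> m _; rewrite mul0r.
- move=> ltj; rewrite !big_nat_recl //= big1 ?addr0; first by ring.
  by move=> m _; rewrite mulr0.
- move=> ltj; rewrite !big_nat_recl //= eqSS -Uo // [in RHS]big_nat_recl // addrA.
  congr (_ + _).
  by rewrite -[RHS]mul1r -cs1; ring.
- rewrite !big_nat_recl //= big1 ?addr0 // => m _.
  by rewrite expr0n mul0r.
- rewrite !big_nat_recl //= -Ud // big_nat_recl //= addrA; congr (_ + _).
  by rewrite -csw; ring.
Qed.

(** The first entry of [l] that is at most [z] and its predecessor straddle [z]. Their adjacency
    lets [horn] control partial sums after merging them. *)
Lemma split_at (R : realDomainType) (x z : R) (l : seq R) :
  z <= x -> has (<= z) l ->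
  exists l1 x' y' l2, [/\ x :: l = l1 ++ [:: x', y' & l2], z <= x' & y' <= z].
Proof.
elim: l x => [|y l IH] x //= zx.
have [yz _|/ltW zy /= lz] := leP y z; first by exists [::], x, y, l.
have [l1 [x' [y' [l2 [-> zx' yz']]]]] := IH _ zy lz.
by exists (x :: l1), x', y', l2.
Qed.

(** Partial sums run in the listed order, without rearrangement; a [j] past the end repeats the
    total, since [take] saturates. *)
Definition majorizes (R : numDomainType) (l a : seq R) :=
  [/\ size a = size l,
      forall j, \sum_(x <- take j a) x <= \sum_(x <- take j l) x
    & \sum_(x <- a) x = \sum_(x <- l) x].

(** Otherwise [y :: w :: l] would have the larger total: [y] is at least [x], and the tails have
    equal length, with entries above [x] in [w :: l] and at most [x] in [a]. *)
Lemma majorizes_has (R : realDomainType) (l a : seq R) (x y w : R) :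
  all (<= x) a -> majorizes [:: y, w & l] (x :: a) -> has (<= x) (w :: l).
Proof.
move=> ax [[sz] maj tot]; rewrite -[has _ _]negbK -all_predC; apply/negP => lx.
have xy : x <= y by move: (maj 1%N); rewrite /= !take0 !big_seq1.
have lt : \sum_(z <- w :: l) x < \sum_(z <- w :: l) z.
  rewrite big_seq [ltRHS]big_seq; apply: ltr_sum => [|i il].
    by apply/hasP; exists w; rewrite ?inE ?eqxx.
  by rewrite ltNge; exact: (allP lx).
have le : \sum_(z <- a) z <= \sum_(z <- a) x.
  by rewrite big_seq [leRHS]big_seq; apply: ler_sum => i /(allP ax).
have eqc : \sum_(z <- a) x = \sum_(z <- w :: l) x.
  by rewrite !big_const_seq !count_predT sz.
move: tot; rewrite 2!big_cons => /eqP; rewrite lt_eqF //.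
by apply: ler_ltD xy _; rewrite (le_lt_trans le) // eqc.
Qed.

(** Induction on [a]: its largest entry [z] lies between adjacent entries [x'], [y'] of [l]. A
    rotation puts [z] on the diagonal and merges the pair into [x' + y' - z], and majorization
    survives for the shorter lists. *)
Theorem horn (R : rcfType) (l a : seq R) :
  sorted >=%R a -> majorizes l a -> orthogonal_diag l a.
Proof.
elim: a l => [|z a IH] l sa [sz maj tot].
  by exists (fun _ _ => 0) => i; rewrite -sz.
case: l sz maj tot => [|x [|w l]] // sz maj tot.
  case: a sz {IH maj sa} tot => // _; rewrite !big_seq1 => ->.
  exists (fun _ _ => 1) => [[|i] [|j]|[|i]] //= _; rewrite big_nat1 ?mulr1 //.
  by rewrite expr1n mul1r.
have az : all (<= z) a.
  by apply: order_path_min sa => u v t h1 h2; exact: le_trans h2 h1.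
have zx : z <= x by move: (maj 1%N); rewrite /= !take0 !big_seq1.
have := majorizes_has az (And3 sz maj tot).
case/(split_at zx) => l1 [x' [y' [l2 [def_l zx' yz']]]].
rewrite {}def_l in sz maj tot *.
apply: (@orthogonal_diag_perm _ _ [:: x', y' & l1 ++ l2]).
  by rewrite (perm_catCA l1 [:: x'; y'] l2).
apply: orthogonal_diag_cons2 => //.
apply: (@orthogonal_diag_perm _ _ (l1 ++ x' + y' - z :: l2)).
  by rewrite perm_sym (perm_catCA l1 [:: x' + y' - z] l2).
apply: IH; first exact: path_sorted sa.
have sumD (s : seq R) : \sum_(u <- l1 ++ x' + y' - z :: s) u =
    \sum_(u <- l1 ++ [:: x', y' & s]) u - z.
  by rewrite !big_cat !big_cons /=; ring.
split=> [|j|]; last by rewrite sumD -tot big_cons; ring.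
  by move: sz; rewrite !size_cat /= !addnS => -[].
have [lejl|ltlj] := leqP j (size l1).
  (* Before the merged entry the sums of [l] are unchanged, and the first [j] entries of [a] sum to
     at most those of [z :: a]. *)
  rewrite takel_cat //; have := maj j; rewrite takel_cat //; apply: le_trans.
  case: j lejl => [|j] lejl; first by rewrite !take0.
  have ltja : (j < size a)%N.
    move: sz; rewrite size_cat /= !addnS => -[->].
    by rewrite ltnS ltnW // (leq_trans lejl) // leq_addr.
  rewrite (take_nth 0) // -cats1 big_cat big_seq1 /= big_cons addrC lerD2r.
  exact: all_nthP az _ ltja.
(* Past the merged entry, [j] new terms sum to [j + 1] old ones minus [z], so [maj] is used at
   [j + 1]. *)
have [d {j ltlj}->] : exists d, j = (size l1 + d.+1)%N.
  by exists (j - (size l1).+1)%N; rewrite addnS -addSn subnKC.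
have ltF e : (size l1 + e < size l1)%N = false by rewrite ltnNge leq_addr.
have := maj (size l1 + d.+2)%N; rewrite !take_cat !ltF !addKn addnS /=.
by rewrite sumD big_cons addrC -lerBrDr.
Qed.

(** * Spectral theorem relative to a Gram matrix *)

(** Take determinants in [E (X - M) = (X - D) E] over polynomials and cancel the nonzero constant
    det [E]. *)
Lemma char_poly_intertwined (F : fieldType) n (E M D : 'M[F]_n) :
  E \in unitmx -> E *m M = D *m E -> char_poly M = char_poly D.
Proof.
move=> Eu EM; have nzE : \det (map_mx polyC E) != 0.
  by rewrite det_map_mx polyC_eq0 -unitfE -unitmxE.
apply: (mulfI nzE); rewrite [RHS]mulrC -!det_mulmx; congr (\det _).
by rewrite mulmxBr mulmxBl -!map_mxM EM scalar_mxC.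
Qed.

Lemma adjmxM (C : numClosedFieldType) m n p (A : 'M[C]_(m, n)) (B : 'M_(n, p)) :
  (A *m B) ^t* = B ^t* *m A ^t*.
Proof. by rewrite trmx_mul map_mxM. Qed.

Lemma row_mulmx_adj (C : numClosedFieldType) m n (A : 'M[C]_(m, n)) (G : 'M_n) i j :
  (row i A *m G *m (row j A) ^t*) 0 0 = (A *m G *m A ^t*) i j.
Proof. by rewrite -row_mul !mxE; apply: eq_bigr => k _; rewrite !mxE. Qed.

Lemma positive_mx_factor (C : numClosedFieldType) n (G : 'M[C]_n) :
  G ^t* = G -> (forall u : 'rV_n, u != 0 -> 0 < (u *m G *m u ^t*) 0 0) ->
  exists2 B, B \in unitmx & G = B *m B ^t*.
Proof.
move=> Gh Gpos; have Gn : G \is normalmx by apply/normalmxP; rewrite Gh.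
set P := spectralmx G; set d := spectral_diag G.
have Pu : P \is unitarymx := spectral_unitarymx G.
have PP : P *m P ^t* = 1%:M by apply/unitarymxP.
have Gd : G = P ^t* *m diag_mx d *m P.
  by rewrite -(invmx_unitary Pu); apply/orthomx_spectralP.
(* [d 0 i] is the value of the form at row [i] of [P], a unit vector. *)
have d_gt0 i : 0 < d 0 i.
  have : row i P != 0.
    apply/eqP => r0; have /eqP : (row i P *m 1%:M *m (row i P) ^t*) 0 0 = 1.
      by rewrite row_mulmx_adj mulmx1 PP mxE eqxx.
    by rewrite r0 !mul0mx mxE eq_sym oner_eq0.
  move/Gpos; rewrite row_mulmx_adj Gd !mulmxA PP mul1mx -mulmxA PP mulmx1.
  by rewrite mxE eqxx.
pose s := \row_i sqrtC (d 0 i); have sh : (diag_mx s) ^t* = diag_mx s.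
  rewrite tr_diag_mx map_diag_mx; congr diag_mx; apply/rowP => i; rewrite !mxE.
  by apply/CrealP/ger0_real; rewrite sqrtC_ge0 ltW.
exists (P ^t* *m diag_mx s).
  rewrite unitmx_mul unitarymx_unit ?trmxC_unitary //= unitmxE det_diag unitfE.
  by apply/prodf_neq0 => i _; rewrite mxE sqrtC_eq0 gt_eqF.
rewrite adjmxM sh trmxCK mulmxA -[_ *m _ *m diag_mx s]mulmxA mulmx_diag Gd.
by congr (_ *m diag_mx _ *m _); apply/rowP => i; rewrite !mxE -expr2 sqrtCK.
Qed.

(* The spectral theorem for an operator M, acting on row vectors, that is
   self-adjoint for the inner product with Gram matrix G. *)
Lemma spectral_gram (C : numClosedFieldType) n (G M : 'M[C]_n) :
  G ^t* = G -> (forall u : 'rV_n, u != 0 -> 0 < (u *m G *m u ^t*) 0 0) ->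
  M *m G = G *m M ^t* ->
  exists (E : 'M_n) (d : 'rV_n), [/\ E *m G *m E ^t* = 1%:M, E *m M = diag_mx d *m E
                & char_poly M = \prod_i ('X - (d 0 i)%:P)].
Proof.
move=> Gh Gpos MG; have [B Bu defG] := positive_mx_factor Gh Gpos.
have BhK : B ^t* *m (invmx B) ^t* = 1%:M.
  by rewrite -adjmxM mulVmx // trmx1 map_mx1.
(* Conjugation by [B] turns self-adjointness relative to [G] into ordinary Hermitian symmetry. *)
pose H := invmx B *m M *m B; have Hn : H \is normalmx.
  suff HH : H ^t* = H by apply/normalmxP; rewrite HH.
  have Bhu : B ^t* \in unitmx by have [] := mulmx1_unit BhK.
  apply: (can_inj (mulKmx Bu)); apply: (can_inj (mulmxK Bhu)).
  rewrite /H !adjmxM !mulmxA -defG mulmxV // mul1mx -[M *m _ *m _]mulmxA -defG MG.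
  by rewrite -!mulmxA -adjmxM mulmxV // trmx1 map_mx1 mulmx1.
set Q := spectralmx H; set d := spectral_diag H.
have Qu : Q \is unitarymx := spectral_unitarymx H.
have HE : Q *m H = diag_mx d *m Q.
  have -> : H = invmx Q *m diag_mx d *m Q by exact/orthomx_spectralP.
  by rewrite !mulmxA mulmxV ?unitarymx_unit // mul1mx.
have EM : Q *m invmx B *m M = diag_mx d *m (Q *m invmx B).
  by rewrite mulmxA -HE -!mulmxA mulmxV // mulmx1.
exists (Q *m invmx B), d; split=> //.
  rewrite adjmxM defG !mulmxA mulmxKV // -[Q *m _ *m _]mulmxA BhK mulmx1.
  exact/unitarymxP.
rewrite (char_poly_intertwined _ EM) ?char_poly_trig ?diag_mx_is_trig //.
  by apply: eq_bigr => i _; rewrite mxE eqxx.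
by rewrite unitmx_mul unitarymx_unit // unitmx_inv.
Qed.

(** * Orthonormal eigenbases of self-adjoint operators *)

Lemma sesqui_sum (R : realType) (K : vectType R[i]) (h : {sesquilinear K over R})
    m n (u : 'I_m -> R[i]) (w : 'I_n -> R[i]) (e : 'I_m -> K) (f : 'I_n -> K) :
  h (\sum_i u i *: e i) (\sum_j w j *: f j) =
  \sum_i \sum_j u i * (w j)^* * h (e i) (f j).
Proof.
rewrite linear_sumlz; apply: eq_bigr => i _; rewrite linear_sumr.
by apply: eq_bigr => j _; rewrite linearZl_LR linearZr_LR /= mulrA.
Qed.

Lemma sesqui_gram (R : realType) (K : vectType R[i]) (h : {sesquilinear K over R})
    n (b : 'I_n -> K) (u w : 'rV_n) :
  h (\sum_i u 0 i *: b i) (\sum_j w 0 j *: b j) =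
  (u *m (\matrix_(i, j) h (b i) (b j)) *m w ^t*) 0 0.
Proof.
rewrite sesqui_sum exchange_big mxE; apply: eq_bigr => j _ /=.
rewrite !mxE mulr_suml; apply: eq_bigr => i _.
by rewrite !mxE mulrAC.
Qed.

(** [spectral_gram] is applied in coordinates; the eigenvalues it yields are roots of the same
    polynomial as [l], hence match [l] up to a permutation. *)
Lemma orthonormal_eigenbasis (R : realType) (K : vectType R[i])
    (h : {sesquilinear K over R}) (T : 'End(K)) N (l : 'I_N -> R) :
  inner_product_on h fullv -> (forall x y, h (T x) y = h x (T y)) ->
  \dim {:K} = N -> eigenvalues_with_mult T l ->
  exists e : 'I_N -> K, [/\ forall i j, h (e i) (e j) = (i == j)%:R,
    forall i, T (e i) = (l i)%:C *: e i & forall x, x = \sum_i h x (e i) *: e i].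
Proof.
move=> [hC h_gt0] Tsa dimK; move: l; rewrite -{}dimK => {N} l Tl.
pose b := vbasis {:K}; have bb : basis_of {:K} b by exact: vbasisP.
pose v := passmx.vecof b; pose M := passmx.mxof b b T.
pose G : 'M_(\dim {:K}) := \matrix_(i, j) h b`_i b`_j.
have hG u w : h (v u) (v w) = (u *m G *m w ^t*) 0 0 by exact: sesqui_gram.
have vM u A : v (u *m A) = \sum_i u 0 i *: v (row i A).
  rewrite {1}/v /passmx.vecof; under [RHS]eq_bigr do rewrite scaler_sumr.
  rewrite exchange_big; apply: eq_bigr => j _ /=; rewrite mxE scaler_suml.
  by apply: eq_bigr => i _; rewrite scalerA mxE.
have [||| E [d [EG EM Md]]] := @spectral_gram _ _ G M.
- by apply/matrixP => i j; rewrite !mxE -hC ?memvf.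
- move=> u u0; rewrite -hG h_gt0 ?memvf //.
  by rewrite passmx.vecof_eq0.
- apply/matrixP => i j.
  (* Self-adjointness is an identity between forms; evaluating it at standard basis vectors gives
     the equality of matrices. *)
  have key (u w : 'rV_(\dim {:K})) :
      (u *m (M *m G) *m w ^t*) 0 0 = (u *m (G *m M ^t*) *m w ^t*) 0 0.
    rewrite !mulmxA -hG -[_ *m M ^t* *m _]mulmxA -adjmxM -hG.
    by rewrite /v -!(passmx.hom_vecof b bb) Tsa.
  have := key (row i 1%:M) (row j 1%:M).
  by rewrite !row_mulmx_adj !mul1mx trmx1 map_mx1 !mulmx1.
have [p dp] : exists p : 'S_(\dim {:K}), forall i, (l i)%:C = d 0 (p i).
  pose lC := [tuple (l i)%:C | i < \dim {:K}].
  have [|p pl] := @tuple_permP _ _ lC [tuple d 0 i | i < \dim {:K}] _.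
    apply: prod_XsubC_eq; rewrite !big_tuple.
    under eq_bigr do rewrite tnth_mktuple; under [RHS]eq_bigr do rewrite tnth_mktuple.
    by rewrite -Md -Tl.
  by exists p => i; have /(congr1 (nth 0 ^~ i)) := pl; rewrite !nth_mktuple tnth_mktuple.
have ee i j : h (v (row i E)) (v (row j E)) = (i == j)%:R.
  by rewrite hG row_mulmx_adj EG mxE.
exists (fun i => v (row (p i) E)); split=> [i j|i|x].
- by rewrite ee (inj_eq perm_inj).
- rewrite {1}/v (passmx.hom_vecof b bb) -/v -row_mul EM row_mul vM (bigD1 (p i)) //=.
  rewrite big1 ?addr0 ?mxE ?eqxx ?dp // => j ji.
  by rewrite !mxE eq_sym (negPf ji) scale0r.
(* [E] is invertible, so its rows span; orthonormality then identifies the coefficients. *)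
have [Eu _] : E \in unitmx /\ G *m E ^t* \in unitmx.
  by apply: mulmx1_unit; rewrite mulmxA.
have [c ->] : exists c : 'rV_(\dim {:K}), x = \sum_i c 0 (p i) *: v (row (p i) E).
  exists (passmx.rVof b x *m invmx E); rewrite -[LHS](passmx.rVofK bb).
  rewrite -[passmx.rVof b x in LHS](mulmxKV Eu) -/v vM.
  by rewrite (reindex_inj (@perm_inj _ p)).
apply: eq_bigr => j _; congr (_ *: _); rewrite linear_sumlz (bigD1 j) //= big1.
  by rewrite linearZl_LR /= ee eqxx mulr1 addr0.
by move=> i ij; rewrite linearZl_LR /= ee (inj_eq perm_inj) (negPf ij) mulr0.
Qed.

(** * Row norms bounded by the largest eigenvalues *)

Lemma sum_ord_lt (R : pzSemiRingType) n j : (j <= n)%N ->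
  \sum_(i < n | (i < j)%N) (1 : R) = j%:R.
Proof. by move=> le_jn; rewrite -(big_ord_widen _ (fun=> 1)) // sumr_const card_ord. Qed.

(** Let [c] be the [j]-th entry of [l], at index [j.-1]. As [(l i - c) * (1 - w i)] is nonnegative
    before index [j] and [(c - l i) * w i] from [j] on, left minus right is at most
    [c * (\sum_i w i - j%:R)]. *)
Lemma weighted_sum_le_top (C : numDomainType) N (l w : 'I_N -> C) j :
  (forall i i' : 'I_N, (i <= i')%N -> l i' <= l i) -> (forall i, 0 <= l i) ->
  (forall i, 0 <= w i <= 1) -> (1 <= j <= N)%N -> \sum_i w i <= j%:R ->
  \sum_i l i * w i <= \sum_(i < N | (i < j)%N) l i.
Proof.
move=> l_noninc l_ge0 w01 /andP[j_gt0 le_jN] sumw.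
have ltm : (j.-1 < N)%N by rewrite prednK.
pose c := l (Ordinal ltm); rewrite -subr_le0 [X in _ - X]big_mkcond -sumrB.
have tw : c * (\sum_i w i - j%:R) <= 0.
  by rewrite mulr_ge0_le0 ?l_ge0 // subr_le0.
apply: le_trans tw; rewrite -(sum_ord_lt _ le_jN) [X in _ - X]big_mkcond -sumrB mulr_sumr.
apply: ler_sum => i _; rewrite -subr_ge0; have /andP[w0 w1] := w01 i.
case: ltnP => ij.
  rewrite (_ : _ - _ = (l i - c) * (1 - w i)); last by ring.
  by rewrite mulr_ge0 ?subr_ge0 // l_noninc //= -ltnS prednK.
rewrite (_ : _ - _ = (c - l i) * w i); last by ring.
by rewrite mulr_ge0 ?subr_ge0 // l_noninc //= (leq_trans _ ij) // leq_pred.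
Qed.

(** [P n n] is the sum of the squares of the moduli in row [n], hence at least its own square. *)
Lemma projection_diag_le1 (C : numClosedFieldType) k (P : 'M[C]_k) n :
  P ^t* = P -> P *m P = P -> 0 <= P n n <= 1.
Proof.
move=> Ph PP; have Pnn : P n n = \sum_m `|P n m| ^+ 2.
  rewrite -{1}PP mxE; apply: eq_bigr => m _.
  by rewrite normCK; congr (_ * _); rewrite -{1}Ph !mxE.
have P_ge0 : 0 <= P n n by rewrite Pnn sumr_ge0 // => m _; rewrite exprn_ge0.
rewrite P_ge0 /=; have [->|Pn0] := eqVneq (P n n) 0; first exact: ler01.
have Pn_gt0 : 0 < P n n by rewrite lt_def Pn0.
rewrite -(ler_pM2r Pn_gt0) mul1r [leRHS]Pnn (bigD1 n) //= ger0_norm // expr2 lerDl.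
by rewrite sumr_ge0 // => m _; rewrite exprn_ge0.
Qed.

Lemma row_norms_majorized (C : numClosedFieldType) k N (X : 'M[C]_(k, N)) (l : 'rV_N) j :
  (forall i i' : 'I_N, (i <= i')%N -> l 0 i' <= l 0 i) -> (forall i, 0 < l 0 i) ->
  X ^t* *m X = diag_mx l -> (1 <= j <= N)%N -> (N <= k)%N ->
  \sum_(n < k | (n < j)%N) \sum_i `|X n i| ^+ 2 <= \sum_(i < N | (i < j)%N) l 0 i.
Proof.
move=> l_noninc l_gt0 XX jN Nk; have /andP[j_gt0 le_jN] := jN.
(* [w i] is the weight that the first [j] rows put on the eigenvalue [l 0 i]. *)
pose w i := \sum_(n < k | (n < j)%N) `|X n i| ^+ 2 / l 0 i.
have -> : \sum_(n < k | (n < j)%N) \sum_i `|X n i| ^+ 2 = \sum_i l 0 i * w i.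
  rewrite exchange_big; apply: eq_bigr => i _; rewrite mulr_sumr; apply: eq_bigr => n _.
  by rewrite mulrC divfK ?gt_eqF.
have X_ge0 n i : 0 <= `|X n i| ^+ 2 / l 0 i by rewrite divr_ge0 ?exprn_ge0 // ltW.
apply: weighted_sum_le_top => // [i|i|]; first exact: ltW.
  (* All rows together put weight 1 on column [i], by the diagonal of [XX]. *)
  rewrite sumr_ge0 //=; apply: (@le_trans _ _ (\sum_n `|X n i| ^+ 2 / l 0 i)).
    by rewrite [leRHS](bigID (fun n : 'I_k => (n < j)%N)) /= lerDl sumr_ge0.
  have /matrixP/(_ i i) := XX; rewrite !mxE eqxx mulr1n => Xi.
  rewrite -mulr_suml (eq_bigr (fun n => X ^t* i n * X n i)) ?Xi ?divff ?gt_eqF //.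
  by move=> n _; rewrite !mxE normCK mulrC.
rewrite exchange_big /= -(sum_ord_lt _ (leq_trans le_jN Nk)); apply: ler_sum => n _.
(* The weights in row [n] sum to a diagonal entry of [P], which is a projection by [XX]; hence they
   sum to at most 1. *)
pose li : 'rV_N := \row_i (l 0 i)^-1; pose P := X *m diag_mx li *m X ^t*.
have Pn : \sum_i `|X n i| ^+ 2 / l 0 i = P n n.
  rewrite /P mul_mx_diag !mxE; apply: eq_bigr => i _.
  by rewrite !mxE normCK mulrAC.
have Ph : P ^t* = P.
  rewrite !adjmxM trmxCK mulmxA tr_diag_mx map_diag_mx; congr (_ *m diag_mx _ *m _).
  apply/rowP => i; rewrite !mxE; apply/CrealP.
  by rewrite realV ger0_real // ltW.
have PP : P *m P = P.
  rewrite /P -!mulmxA; congr (_ *m _); rewrite !mulmxA -[_ *m X ^t* *m X]mulmxA XX.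
  rewrite !mulmx_diag; congr (diag_mx _ *m _); apply/rowP => i.
  by rewrite !mxE mulVf ?mul1r // gt_eqF.
by rewrite Pn; have /andP[] := projection_diag_le1 n Ph PP.
Qed.

(** * Horn's theorem for rectangular matrices *)

Lemma take_enum_ord n j : take j (enum 'I_n) = [seq i : 'I_n <- enum 'I_n | (i < j)%N].
Proof.
apply: (inj_map val_inj).
have -> : map val [seq i : 'I_n <- enum 'I_n | (i < j)%N] =
    [seq i <- map val (enum 'I_n) | (i < j)%N] by rewrite filter_map.
rewrite map_take val_enum_ord.
have [le_nj|/ltnW le_jn] := leqP n j.
  rewrite take_oversize ?size_iota // (eq_in_filter (a2 := predT)) ?filter_predT //.
  by move=> i; rewrite mem_iota => /andP[_ /leq_trans->].
by rewrite take_iota (minn_idPl le_jn); exact/esym/(filter_iota_ltn 0 le_jn).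
Qed.

Lemma big_take_ord (R : nmodType) n (F : 'I_n -> R) j :
  \sum_(x <- take j [seq F i | i <- enum 'I_n]) x = \sum_(i < n | (i < j)%N) F i.
Proof.
by rewrite -map_take big_map take_enum_ord big_filter big_enum_cond.
Qed.

Lemma sorted_map_ord (R : numDomainType) n (F : 'I_n -> R) :
  (forall i j : 'I_n, (i <= j)%N -> F j <= F i) ->
  sorted >=%R [seq F i | i <- enum 'I_n].
Proof.
move=> F_noninc; rewrite sorted_map.
apply: (@sub_sorted _ (relpre val leq)) => [i j|]; first exact: F_noninc.
by rewrite -sorted_map val_enum_ord iota_sorted.
Qed.

Lemma horn_rect (R : rcfType) N k (l : 'I_N -> R) (b : 'I_k -> R) :
  (N <= k)%N -> (forall i, 0 <= l i) -> (forall n, 0 <= b n) ->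
  (forall i j : 'I_k, (i <= j)%N -> b j <= b i) ->
  (forall j, (1 <= j <= N)%N ->
     \sum_(n < k | (n < j)%N) b n <= \sum_(n < N | (n < j)%N) l n) ->
  \sum_n b n = \sum_n l n ->
  exists V : 'I_k -> 'I_N -> R,
    (forall i j, \sum_n V n i * V n j = l i *+ (i == j)) /\
    forall n, \sum_i V n i ^+ 2 = b n.
Proof.
move=> le_Nk l_ge0 b_ge0 b_noninc maj tot.
pose bs := [seq b n | n <- enum 'I_k]; pose l1 := [seq l i | i <- enum 'I_N].
pose ls := l1 ++ nseq (k - N) 0.
have szb : size bs = k by rewrite size_map size_enum_ord.
have szl1 : size l1 = N by rewrite size_map size_enum_ord.
have szl : size ls = k by rewrite size_cat szl1 size_nseq subnKC.
have sum_b : \sum_(x <- bs) x = \sum_n b n by rewrite big_map big_enum.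
have sum_l : \sum_(x <- l1) x = \sum_n l n by rewrite big_map big_enum.
have sum0 m m' : \sum_(x <- take m (nseq m' (0 : R))) x = 0.
  by rewrite big1_seq // => x /= /mem_take; rewrite mem_nseq => /andP[_ /eqP].
have [|U Uo Ud] := @horn _ ls bs (sorted_map_ord b_noninc).
  split=> [|j|]; [by rewrite szb szl | | ]; last first.
    by rewrite sum_b tot big_cat sum_l -(take_size (nseq _ _)) sum0 /= addr0.
  have [->|j_gt0] := posnP j; first by rewrite !take0 big_nil.
  have [le_jN|lt_Nj] := leqP j N.
    by rewrite takel_cat ?szl1 // !big_take_ord maj // j_gt0.
  (* For [j] beyond [N] the right side is already the total of [b], whose entries are
     nonnegative. *)
  rewrite take_cat szl1 ltnNge (ltnW lt_Nj) big_cat sum_l sum0 -tot /= addr0.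
  rewrite big_take_ord big_mkcond; apply: ler_sum => n _.
  by case: ifP.
pose W := \matrix_(i < k, j < k) U i j.
have WW : W *m W^T = 1%:M.
  apply/matrixP => i j; rewrite !mxE.
  have := Uo i j; rewrite szl big_mkord => /(_ (ltn_ord i) (ltn_ord j)) <-.
  by apply: eq_bigr => m _; rewrite !mxE.
have sum_widen (F : nat -> R) :
    \sum_(m < k) F m * ls`_m = \sum_(i < N) F i * l i.
  rewrite (bigID (fun m : 'I_k => (m < N)%N)) /= addrC big1 => [|m lt_mN].
    rewrite add0r (big_ord_narrow le_Nk) /=; apply: eq_bigr => i _; congr (_ * _).
    rewrite nth_cat szl1 ltn_ord (nth_map i) ?size_enum_ord //.
    by rewrite nth_ord_enum.
  by rewrite nth_cat szl1 (negPf lt_mN) nth_nseq if_same mulr0.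
exists (fun (n : 'I_k) (i : 'I_N) => U n i * Num.sqrt (l i)); split=> [i j|n].
  pose wd := widen_ord le_Nk.
  rewrite (eq_bigr (fun n : 'I_k =>
      W^T (wd i) n * W n (wd j) * (Num.sqrt (l i) * Num.sqrt (l j)))).
    (* [W] is square, so orthonormal rows give orthonormal columns. *)
    rewrite -mulr_suml; have /matrixP/(_ (wd i) (wd j)) := mulmx1C WW.
    rewrite !mxE => ->; rewrite -val_eqE /= val_eqE.
    by case: eqP => [->|_]; rewrite ?mul0r // mul1r -expr2 sqr_sqrtr.
  by move=> n _; rewrite !mxE mulrACA.
have := Ud n; rewrite szl ltn_ord (nth_map n) ?size_enum_ord // nth_ord_enum => <- //.
rewrite big_mkord (sum_widen (fun m => U n m ^+ 2)); apply: eq_bigr => i _.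
by rewrite exprMn sqr_sqrtr.
Qed.

(** * Frame operators in an orthonormal eigenbasis *)

Lemma realc_conj (R : realType) (r : R) : (r%:C)^* = r%:C.
Proof. exact: conjc_real. Qed.

Lemma ler_1D_sum (R : numDomainType) N (g : 'I_N -> R) i :
  (forall j, 0 < g j) -> g i <= 1 + \sum_j g j.
Proof.
move=> g_gt0; rewrite (bigD1 i) //= addrCA lerDl addr_ge0 // sumr_ge0 // => j _.
exact: ltW.
Qed.

Section EigenbasisFrames.
Variables (R : realType) (K : vectType R[i]) (h : {sesquilinear K over R}).
Hypothesis h_inner : inner_product_on h fullv.
Variables (N : nat) (T : 'End(K)) (l : 'I_N -> R) (e : 'I_N -> K).
Hypothesis e_orth : forall i j, h (e i) (e j) = (i == j)%:R.
Hypothesis Te : forall i, T (e i) = (l i)%:C *: e i.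
Hypothesis e_exp : forall x, x = \sum_i h x (e i) *: e i.
Hypothesis l_gt0 : forall i, 0 < l i.

Lemma inner_conj x y : h y x = (h x y)^*.
Proof. by have [hC _] := h_inner; rewrite hC ?memvf. Qed.

(** This turns the frame inequality into bounds on the quadratic form of the frame operator. *)
Lemma frame_operator_form k (x_ : 'I_k -> K) x :
  h (frame_operator h x_ x) x = \sum_n `|h (x_ n) x| ^+ 2.
Proof.
rewrite linear_sumlz; apply: eq_bigr => n _.
by rewrite linearZl_LR /= (inner_conj (x_ n) x) normCK mulrC.
Qed.

Lemma eigen_form x : h (T x) x = \sum_i (l i)%:C * `|h x (e i)| ^+ 2.
Proof.
rewrite {1}(e_exp x) linear_sum linear_sumlz; apply: eq_bigr => i _.
by rewrite linearZ linearZl_LR /= Te linearZl_LR /= (inner_conj x) normCK mulrCA.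
Qed.

Lemma parseval x : h x x = \sum_i `|h x (e i)| ^+ 2.
Proof.
rewrite {1}(e_exp x) linear_sumlz; apply: eq_bigr => i _.
by rewrite linearZl_LR /= (inner_conj x) normCK.
Qed.

Lemma eigen_form_bounds : exists A B : R, [/\ 0 < A, A <= B & forall x,
  A%:C * h x x <= h (T x) x <= B%:C * h x x].
Proof.
have s_ge1 (g : 'I_N -> R) : (forall j, 0 < g j) -> 1 <= 1 + \sum_j g j.
  by move=> g_gt0; rewrite lerDl sumr_ge0 // => j _; apply: ltW.
have li_gt0 j : 0 < (l j)^-1 by rewrite invr_gt0.
have inv_gt0 : 0 < 1 + \sum_j (l j)^-1 by apply: lt_le_trans (s_ge1 _ li_gt0).
(* Crude bounds on all eigenvalues; the added 1 gives [A <= 1 <= B] at once. *)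
exists (1 + \sum_j (l j)^-1)^-1, (1 + \sum_j l j); split.
- by rewrite invr_gt0.
- by apply: (@le_trans _ _ 1); rewrite ?invf_le1 // s_ge1.
move=> x; rewrite eigen_form parseval !mulr_sumr.
apply/andP; split; apply: ler_sum => i _; rewrite ler_wpM2r ?exprn_ge0 // lecR.
  by rewrite -[leRHS]invrK lef_pV2 ?posrE // (ler_1D_sum _ li_gt0).
exact: ler_1D_sum.
Qed.

Lemma frame_operator_majorized k (x_ : 'I_k -> K) (a : 'I_k -> R) :
  (forall i j : 'I_N, (i <= j)%N -> l j <= l i) -> (N <= k)%N ->
  frame_operator h x_ =1 T -> (forall n, h (x_ n) (x_ n) = (a n ^+ 2)%:C) ->
  (forall j : nat, (1 <= j <= N)%N ->
     \sum_(n < k | (n < j)%N) a n ^+ 2 <= \sum_(n < N | (n < j)%N) l n)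
  /\ \sum_(n < k) a n ^+ 2 = \sum_(n < N) l n.
Proof.
move=> l_noninc le_Nk xT xa.
pose X : 'M[R[i]]_(k, N) := \matrix_(n, i) h (x_ n) (e i).
pose L : 'rV[R[i]]_N := \row_i (l i)%:C.
have XX : X ^t* *m X = diag_mx L.
  (* Summing over [n] reassembles the frame operator applied to [e i]. *)
  apply/matrixP => i j; rewrite !mxE; transitivity (h (T (e i)) (e j)).
    rewrite -xT linear_sumlz; apply: eq_bigr => n _.
    by rewrite !mxE linearZl_LR /= (inner_conj (x_ n) (e i)).
  by rewrite Te linearZl_LR /= e_orth mulr_natr.
have rowX n : \sum_i `|X n i| ^+ 2 = (a n ^+ 2)%:C.
  by rewrite -xa parseval; apply: eq_bigr => i _; rewrite mxE.
split=> [j jN|].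
  rewrite -lecR !rmorph_sum /=.
  have := @row_norms_majorized _ _ _ X L j _ _ XX jN le_Nk.
  rewrite (eq_bigr _ (fun n _ => rowX n)) (eq_bigr (fun i => (l i)%:C)); first apply.
    by move=> i i' ii'; rewrite !mxE lecR l_noninc.
    by move=> i; rewrite mxE ltcR.
  by move=> i _; rewrite mxE.
(* Both totals are the sum of all [|X n i|^2], by rows and by columns. *)
apply: (@complexI R); rewrite !rmorph_sum /=; rewrite -(eq_bigr _ (fun n _ => rowX n)).
rewrite exchange_big; apply: eq_bigr => i _ /=.
have /matrixP/(_ i i) := XX; rewrite !mxE eqxx mulr1n => <-.
by apply: eq_bigr => n _; rewrite !mxE normCK mulrC.
Qed.

Lemma majorized_frame_operator k (a : 'I_k -> R) :
  (N <= k)%N -> (forall i, 0 < a i) -> (forall i j : 'I_k, (i <= j)%N -> a j <= a i) ->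
  (forall j : nat, (1 <= j <= N)%N ->
     \sum_(n < k | (n < j)%N) a n ^+ 2 <= \sum_(n < N | (n < j)%N) l n) ->
  \sum_(n < k) a n ^+ 2 = \sum_(n < N) l n ->
  exists2 x_ : 'I_k -> K, frame_operator h x_ =1 T &
    forall n, h (x_ n) (x_ n) = (a n ^+ 2)%:C.
Proof.
move=> le_Nk a_gt0 a_noninc maj tot.
have [|||V [VV Va]] := @horn_rect _ _ _ l (fun n => a n ^+ 2) le_Nk _ _ _ maj tot.
- by move=> i; rewrite ltW.
- by move=> n; rewrite sqr_ge0.
- by move=> i j ij; rewrite ler_sqr ?nnegrE ?(ltW (a_gt0 _)) ?a_noninc.
(* Row [n] of [V] holds the coordinates of the [n]-th vector. The columns of [V] are orthogonal with
   squared norms [l], so the frame operator is diagonal in [e]. *)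
exists (fun n => \sum_i (V n i)%:C *: e i) => [x|n].
  rewrite {2}(e_exp x) linear_sum /frame_operator.
  transitivity (\sum_n \sum_i \sum_j ((V n i * V n j)%:C * h x (e i)) *: e j).
    apply: eq_bigr => n _; rewrite scaler_sumr exchange_big; apply: eq_bigr => j _ /=.
    rewrite scalerA linear_sumr mulr_suml -[RHS]scaler_suml; congr (_ *: _).
    apply: eq_bigr => i _; rewrite linearZr_LR /= rmorphM /= mulrAC.
    by rewrite realc_conj.
  rewrite exchange_big; apply: eq_bigr => i _; rewrite exchange_big linearZ /= Te.
  have VVi j : \sum_n ((V n i * V n j)%:C * h x (e i)) *: e j =
      ((l i *+ (i == j))%:C * h x (e i)) *: e j.
    by rewrite -[LHS]scaler_suml -mulr_suml -rmorph_sum VV.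
  rewrite (eq_bigr _ (fun j _ => VVi j)) (bigD1 i) //= big1 ?addr0 => [|j ji].
    by rewrite eqxx mulr1n mulrC scalerA.
  by rewrite eq_sym (negPf ji) mul0r scale0r.
rewrite sesqui_sum -Va rmorph_sum; apply: eq_bigr => i _ /=.
rewrite (bigD1 i) //= big1 ?addr0 => [|j ji]; rewrite e_orth.
  by rewrite eqxx mulr1 realc_conj rmorphXn expr2.
by rewrite eq_sym (negPf ji) mulr0.
Qed.

End EigenbasisFrames.

(** * The fundamental symmetry and its inner product *)

Section FundamentalSymmetry.
Variables (R : realType) (K : vectType R[i]) (form : {sesquilinear K over R}).
Variables Kp Km : {vspace K}.
Local Notation J := (fundamental_symmetry Kp Km).
Local Notation Jform := (J_form form Kp Km).

(** Registering [J_form] as sesquilinear lets the eigenbasis results apply with it as [h]. *)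
Fact J_form_bilinear : bilinear_for *%R (@Num.conj R[i] \; *%R) Jform.
Proof.
split=> [y a x x'|x a y y']; rewrite /J_form.
  by rewrite linearP /= linearDl linearZl_LR.
by rewrite linearP.
Qed.
HB.instance Definition _ := bilinear_isBilinear.Build R[i] K K R[i]
  *%R (@Num.conj R[i] \; *%R) Jform J_form_bilinear.

Hypothesis hK : krein_space form Kp Km.

Lemma krein_decomposition x :
  exists p m, [/\ p \in Kp, m \in Km, x = p + m & J x = p - m].
Proof.
have [[KK K0] _ _ _] := hK.
exists (daddv_pi Kp Km x), (daddv_pi Km Kp x); rewrite !memv_pi; split=> //.
  by rewrite daddv_pi_add // KK memvf.
by rewrite add_lfunE opp_lfunE.
Qed.

Lemma fundamental_symmetryE p m : p \in Kp -> m \in Km -> J (p + m) = p - m.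
Proof.
move=> pK mK; have [[KK K0] _ _ _] := hK.
have K0' : (Km :&: Kp)%VS = 0%VS by rewrite capvC.
have pE := daddv_pi_id K0 pK; have mE := daddv_pi_id K0' mK.
have pm : daddv_pi Km Kp p = 0.
  by apply: (addrI (daddv_pi Kp Km p)); rewrite daddv_pi_add ?KK ?memvf // addr0 pE.
have mp : daddv_pi Kp Km m = 0.
  apply: (addrI (daddv_pi Km Kp m)).
  by rewrite daddv_pi_add // 1?addvC ?KK ?memvf // addr0 mE.
by rewrite add_lfunE opp_lfunE !linearD /= pE mE pm mp addr0 oppr0 add0r.
Qed.

Lemma fundamental_symmetryK : involutive J.
Proof.
move=> x; have [p [m [pK mK xE ->]]] := krein_decomposition x.
by rewrite fundamental_symmetryE ?memvN // opprK -xE.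
Qed.

(** Mixed terms vanish by orthogonality, so on either side [J] only changes the sign of the [Km]
    term. *)
Lemma form_symmetry_adjoint x y : form (J x) y = form x (J y).
Proof.
have [_ orth _ _] := hK.
have [p [m [pK mK -> ->]]] := krein_decomposition x.
have [q [n [qK nK -> ->]]] := krein_decomposition y.
have [pn _] := orth p n pK nK; have [_ mq] := orth q m qK mK.
by rewrite !(linearDl, linearDr, linearNl, linearNr) /= pn mq; ring.
Qed.

Lemma J_formJl x y : Jform (J x) y = form x y.
Proof. by rewrite /J_form fundamental_symmetryK. Qed.

Lemma J_formJr x y : Jform x (J y) = form x y.
Proof. by rewrite /J_form -form_symmetry_adjoint fundamental_symmetryK. Qed.

Lemma J_formJJ x y : Jform (J x) (J y) = Jform x y.
Proof. by rewrite J_formJl -form_symmetry_adjoint. Qed.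

(** In components, [J_form] is [form] on [Kp] plus its negative on [Km], a sum of two inner
    products. *)
Lemma J_form_inner : inner_product_on Jform fullv.
Proof.
have [_ orth [[pC p_gt0] _] [[mC m_gt0] _]] := hK.
have JE p m q n : p \in Kp -> m \in Km -> q \in Kp -> n \in Km ->
    Jform (p + m) (q + n) = form p q - form m n.
  move=> pK mK qK nK; rewrite /J_form fundamental_symmetryE //.
  have [pn _] := orth p n pK nK; have [_ mq] := orth q m qK mK.
  by rewrite linearBl !linearDr /= pn mq; ring.
split=> [x y _ _|x _].
  have [p [m [pK mK -> _]]] := krein_decomposition x.
  have [q [n [qK nK -> _]]] := krein_decomposition y.
  by rewrite !JE // (pC p q) // (mC m n) // rmorphD.
have [p [m [pK mK -> _]]] := krein_decomposition x; rewrite JE // => pm0.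
have p_ge0 : 0 <= form p p.
  by have [->|/p_gt0/ltW->//] := eqVneq p 0; rewrite linear0l.
have [m0|m0] := eqVneq m 0; last by rewrite ltr_wpDl // m_gt0.
by rewrite m0 addr0 in pm0 *; rewrite linear0l subr0 p_gt0.
Qed.

Lemma J_norm_sqr x : J_norm form Kp Km x ^+ 2 = Jform x x.
Proof. exact: sqrtCK. Qed.

Lemma J_normJ x : J_norm form Kp Km (J x) = J_norm form Kp Km x.
Proof. by rewrite /J_norm /form_norm J_formJJ. Qed.

(** [J] preserves the norm, so substituting [J x] for [x] keeps both frame bounds. *)
Lemma frame_for_symmetry (f g : K -> K -> R[i]) k (x_ y_ : 'I_k -> K) :
  (forall n x, f (x_ n) x = g (y_ n) (J x)) ->
  frame_for form Kp Km g y_ -> frame_for form Kp Km f x_.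
Proof.
move=> fg [A [B [A_gt0 AB bounds]]]; exists A, B; split=> // x.
by have := bounds (J x); rewrite J_normJ; under eq_bigr do rewrite -fg.
Qed.

End FundamentalSymmetry.

Theorem proposition2p1 (R : realType) (K : vectType R[i])
    (form : {sesquilinear K over R}) (Kp Km : {vspace K})
    (N : nat) (dimK : \dim {:K} = N)
    (hK : pontryagin_space form Kp Km)
    (S0 : 'End(K))
    (S0_sa : J_self_adjoint form Kp Km S0)
    (S0_pos : J_positive form Kp Km S0)
    (lam : 'I_N -> R)
    (lam_eig : eigenvalues_with_mult S0 lam)
    (lam_noninc : forall i j : 'I_N, (i <= j)%N -> lam j <= lam i)
    (lam_pos : forall i : 'I_N, 0 < lam i)
    (k : nat) (leNk : (N <= k)%N)
    (a : 'I_k -> R)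
    (a_noninc : forall i j : 'I_k, (i <= j)%N -> a j <= a i)
    (a_pos : forall i : 'I_k, 0 < a i) :
  let J := fundamental_symmetry Kp Km in
  let norms_are (x_ : 'I_k -> K) :=
    forall n : 'I_k, J_norm form Kp Km (x_ n) = (a n)%:C in
  [<-> (* (i) *)
       (forall j : nat, (1 <= j <= N)%N ->
          \sum_(n < k | (n < j)%N) a n ^+ 2 <= \sum_(n < N | (n < j)%N) lam n)
       /\ \sum_(n < k) a n ^+ 2 = \sum_(n < N) lam n;
       (* (ii) *)
       exists x_ : 'I_k -> K,
         [/\ hilbert_frame form Kp Km x_,
             hilbert_frame_operator form Kp Km x_ =1 S0
           & norms_are x_];
       (* (iii) *)
       exists x_ : 'I_k -> K,
         [/\ krein_frame form Kp Km x_,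
             krein_frame_operator form x_ =1 (S0 \o J)%VF
           & norms_are x_];
       (* (iv) *)
       exists x_ : 'I_k -> K,
         [/\ krein_frame form Kp Km (fun n => J (x_ n)),
             krein_frame_operator form (fun n => J (x_ n)) =1 (J \o S0)%VF
           & norms_are x_];
       (* (v) *)
       exists x_ : 'I_k -> K,
         [/\ hilbert_frame form Kp Km (fun n => J (x_ n)),
             hilbert_frame_operator form Kp Km (fun n => J (x_ n))
               =1 (J \o S0 \o J)%VF
           & norms_are x_]].
Proof.
move=> J norms_are; have [krein _] := hK.
have inner := J_form_inner krein.
have JK : involutive J := fundamental_symmetryK krein.
have Jadj x y : form (J x) y = form x (J y) := form_symmetry_adjoint krein x y.
have Jl x y : J_form form Kp Km (J x) y = form x y := J_formJl krein x y.
have Jr x y : J_form form Kp Km x (J y) = form x y := J_formJr krein x y.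
have [e [e_orth eE e_exp]] := orthonormal_eigenbasis inner S0_sa dimK lam_eig.
tfae.
- case=> maj tot.
  have [x_ xS xa] :=
    majorized_frame_operator e_orth eE e_exp lam_pos leNk a_pos a_noninc maj tot.
  exists x_; split=> // [|n].
    have [A [B [A_gt0 AB bounds]]] := eigen_form_bounds inner eE e_exp lam_pos.
    exists A, B; split=> // x.
    rewrite J_norm_sqr; have := bounds x.
    by rewrite -xS (frame_operator_form inner).
  have {}xa : J_form form Kp Km (x_ n) (x_ n) = _ := xa n.
  by rewrite /J_norm /form_norm xa rmorphXn sqrCK // ler0c ltW.
(* From (ii) to (iii) with the same family: [x, x_n] = [Jx, x_n]_J precomposes the frame operator
   with [J]. *)
- case=> x_ [fr xS xa]; exists x_; split=> // [|x].
    by apply: frame_for_symmetry fr => // n x; rewrite Jr.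
  rewrite comp_lfunE /= -xS; apply: eq_bigr => n _; congr (_ *: _).
  by rewrite Jl.
(* From (iii) to (iv): [x, J x_n] = [Jx, x_n], so the new operator is [J] ([S0] [J]) [J], that is,
   [J] [S0]. *)
- case=> x_ [fr xS xa]; exists x_; split=> // [|x].
    by apply: frame_for_symmetry fr => // n x; rewrite Jadj.
  rewrite comp_lfunE /= -[x in S0 x]JK -[S0 _](comp_lfunE S0 J) -xS linear_sum.
  apply: eq_bigr => n _; rewrite linearZ; congr (_ *: _).
  by rewrite Jadj.
(* From (iv) to (v): passing from [form] to [J_form] again precomposes with [J]. *)
- case=> x_ [fr xS xa]; exists x_; split=> // [|x].
    by apply: frame_for_symmetry fr => // n x; rewrite Jl Jadj JK.
  rewrite !comp_lfunE /= -[J (S0 _)](comp_lfunE J S0) -xS.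
  by apply: eq_bigr.
(* From (v) to (i): conjugating by [J] shows that the family [x_] itself has Hilbert frame operator
   [S0]. *)
- case=> x_ [_ xS xa].
  apply: (frame_operator_majorized (x_ := x_) inner e_orth eE e_exp lam_pos) => // [x|n].
    have -> : S0 x = J ((J \o S0 \o J)%VF (J x)) by rewrite !comp_lfunE /= !JK.
    rewrite -xS linear_sum; apply: eq_bigr => n _.
    by rewrite linearZ /= JK Jl -Jadj.
  by rewrite -[LHS](J_norm_sqr form Kp Km) xa rmorphXn.
Qed.
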